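(* Let $f(x)=\sum_{n\ge 1} a_n x^n$, where $a_n$ is the number of permutations of length $n$ that avoid both $4312$ and $3142$. Then $f$ satisfies \[ (x^3-2x^2+x)f^4+(4x^3-9x^2+6x-1)f^3+(6x^3-12x^2+7x-1)f^2+(4x^3-5x^2+x)f+x^3=0. \]
   Context: A permutation $\pi$ avoids $\sigma$ if no subsequence of $\pi$ is order-isomorphic to $\sigma$. The generating function counts nonempty permutations only (no constant term). *)

(* Defs.v *)
From mathcomp Require Import all_boot all_order all_algebra all_fingroup.
Set Implicit Arguments. Unset Strict Implicit. Unset Printing Implicit Defensive.
Import GRing.Theory.

(* A pattern is given in one-line notation as a sequence of naturals, e.g.
   4312 is [:: 4; 3; 1; 2].  A permutation p of length n (p : 'S_n, acting on
   {0,...,n-1}) contains the pattern s if there are positions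
   f 0 < f 1 < ... < f (size s - 1) such that p (f i) < p (f j) iff s_i < s_j,
   i.e. the subsequence of p at those positions is order-isomorphic to s. *)
Definition contains_pattern (n : nat) (p : 'S_n) (s : seq nat) : bool :=
  [exists f : {ffun 'I_(size s) -> 'I_n},
    [forall i : 'I_(size s), forall j : 'I_(size s),
      ((i < j)%N ==> (f i < f j)%N) &&
      (((p (f i) < p (f j))%N) == ((nth 0%N s i < nth 0%N s j)%N))]].

Definition avoids (n : nat) (p : 'S_n) (s : seq nat) : bool :=
  ~~ contains_pattern p s.

Definition a_4312_3142 (n : nat) : nat :=
  #|[set p : 'S_n | avoids p [:: 4; 3; 1; 2] && avoids p [:: 3; 1; 4; 2]]|.

Definition f_trunc (N : nat) : {poly int} :=
  \poly_(i < N.+1) (if i == 0%N then 0%R else ((a_4312_3142 i)%:R)%R).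

(* Main.v *)
Require Import Defs.
From mathcomp Require Import all_boot all_order all_algebra all_fingroup.
From mathcomp Require Import ring zify.
Set Implicit Arguments. Unset Strict Implicit. Unset Printing Implicit Defensive.

(* Write a nonempty permutation as L n R with n its maximum. It avoids 4312 and
   3142 iff L does, R avoids 312, no descent of L straddles an entry of R, and two
   more conditions on L and R hold; call such pairs (L, R) admissible, with
   generating function G, so that A = 1 + f satisfies A = 1 + xG. If R is nonempty
   with minimum r, then R = P r Q and L = L0 LP LQ with
   L0 < r < LP, P < LQ, Q in value, where L0 is any avoider, (LP, P) is admissible,
   and (LQ, Q) is such that LQ is increasing, Q avoids 312, no entry of LQ lies in
   value between the entries of a descent of Q, and the minimum of LQ Q is in Q.
   Hence G = A + xAGC. Removing the minimum from the latter pairs gives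
   C = 1 + xcK and K = C + xK, where K drops the condition on the minimum and
   c = 1 + xc^2 counts the 312-avoiders. Eliminating G, C, K, c leaves x times
   the quartic equation for f. *)

(** * Subsequences and forbidden pairs of words *)

Fixpoint subs (T : Type) (s : seq T) : seq (seq T) :=
  if s is x :: s' then [seq x :: t | t <- subs s'] ++ subs s' else [:: [::]].

Lemma mem_subs (T : eqType) (s t : seq T) : (t \in subs s) = subseq t s.
Proof.
elim: s t => [|x s IHs] [|y t] //=; rewrite mem_cat IHs.
  by rewrite sub0seq orbT.
apply/orP/idP => [[/mapP[t' t'P [-> ->]]|yt_s]|].
- by rewrite eqxx -IHs.
- by case: eqP => // _; apply: subseq_trans yt_s; apply: subseq_cons.
- by case: eqP => [->|_] sub_s; [left; rewrite map_f ?IHs | right].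
Qed.

Lemma subs_map (T U : Type) (h : T -> U) (s : seq T) :
  subs (map h s) = map (map h) (subs s).
Proof. by elim: s => //= x s ->; rewrite map_cat -!map_comp. Qed.

Lemma subseq_catP (T : eqType) (t s1 s2 : seq T) : subseq t (s1 ++ s2) ->
  exists t1 t2, [/\ t = t1 ++ t2, subseq t1 s1 & subseq t2 s2].
Proof.
case/subseqP=> m sz_m ->; exists (mask (take (size s1) m) s1), (mask (drop (size s1) m) s2).
rewrite !mask_subseq -mask_cat ?cat_take_drop //.
by rewrite size_takel // sz_m size_cat leq_addr.
Qed.

(* A word is cut into two factors L and R, and a class of such pairs is given by
   the pairs (t, u) of subsequences of L and R that it forbids; a class of plain
   words is encoded by forcing L to be empty. *)
Definition avoid2 (bad : rel (seq nat)) (L R : seq nat) : bool :=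
  all (fun t => all (fun u => ~~ bad t u) (subs R)) (subs L).

Lemma avoid2P bad L R :
  reflect (forall t u, subseq t L -> subseq u R -> ~~ bad t u) (avoid2 bad L R).
Proof.
apply: (iffP allP) => [h t u tL uR | h t].
  by apply: (allP (h t _)); rewrite mem_subs.
by rewrite mem_subs => tL; apply/allP=> u; rewrite mem_subs; apply: h.
Qed.

Lemma avoid2_map bad h L R :
  (forall t u, bad (map h t) (map h u) = bad t u) ->
  avoid2 bad (map h L) (map h R) = avoid2 bad L R.
Proof.
move=> bad_h; rewrite /avoid2 !subs_map all_map; apply: eq_all => t /=.
by rewrite all_map; apply: eq_all => u /=; rewrite bad_h.
Qed.

(** * Counting pairs of words *)

Section Decomposition.
Variables (I T D : eqType) (s : seq I) (X : I -> seq T) (f : I -> T -> D).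

(** In its uses [i] records the sizes of the factors, [X i] lists the factors of these sizes, and
    [f i] glues them together. *)
Lemma size_decomposition (Z : seq D) :
    uniq s -> {in s, forall i, uniq (X i)} -> uniq Z ->
    (forall i x, i \in s -> x \in X i -> f i x \in Z) ->
    (forall z, z \in Z -> exists i x, [/\ i \in s, x \in X i & z = f i x]) ->
    (forall i x j y, i \in s -> x \in X i -> j \in s -> y \in X j ->
       f i x = f j y -> i = j /\ x = y) ->
  size Z = \sum_(i <- s) size (X i).
Proof.
move=> s_uniq X_uniq Z_uniq f_in f_onto f_inj.
have /perm_size-> : perm_eq Z [seq f i x | i <- s, x <- X i].
  apply: uniq_perm => //.
    apply: allpairs_uniq_dep => // -[i x] [j y].
    move=> /allpairsPdep[i' [x' [i's x'X [-> ->]]]] /allpairsPdep[j' [y' [j's y'X [-> ->]]]] /= e.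
    by have [-> ->] := f_inj _ _ _ _ i's x'X j's y'X e.
  move=> z; apply/idP/allpairsPdep => [/f_onto[i [x [? ? ->]]]|[i [x [? ? ->]]]].
    by exists i, x.
  exact: f_in.
by rewrite size_allpairs_dep sumnE big_map.
Qed.
End Decomposition.

Lemma size_bijection (T D : eqType) (f : T -> D) (X : seq T) (Z : seq D) :
    uniq X -> uniq Z -> {in X, forall x, f x \in Z} ->
    {in Z, forall z, exists2 x, x \in X & z = f x} -> {in X &, injective f} ->
  size Z = size X.
Proof.
move=> X_uniq Z_uniq f_in f_onto f_inj; rewrite -(size_map f).
apply/perm_size/uniq_perm; rewrite ?map_inj_in_uniq // => z.
by apply/idP/mapP => [/f_onto|[x /f_in ? ->]].
Qed.

Definition cuts (b n : nat) : seq (seq nat * seq nat) :=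
  [seq (take k s, drop k s) | s <- permutations (iota b n), k <- iota 0 n.+1].

(* Words are taken on the values b, ..., b + n - 1 rather than 0, ..., n - 1, so that
   the factors of a decomposition need not be renumbered. *)
Definition onto (b n : nat) (s : seq nat) : Prop :=
  uniq s /\ forall v, (v \in s) = (b <= v < b + n).

Lemma perm_iotaP b n s : reflect (onto b n s) (perm_eq s (iota b n)).
Proof.
apply: (iffP idP) => [ps|[us ms]].
  by split=> [|v]; rewrite ?(perm_uniq ps) ?iota_uniq ?(perm_mem ps) ?mem_iota.
by apply: uniq_perm; rewrite ?iota_uniq // => v; rewrite ms mem_iota.
Qed.

Lemma mem_cuts b n z : reflect (onto b n (z.1 ++ z.2)) (z \in cuts b n).
Proof.
apply: (iffP allpairsP) => [[[s k] /= [sP _ ->]]|zP].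
  by rewrite /= cat_take_drop; apply/perm_iotaP; rewrite mem_permutations in sP.
case: z zP => L R zP; exists (L ++ R, size L); split.
- by rewrite mem_permutations; apply/perm_iotaP.
- have /perm_iotaP/perm_size := zP.
  by rewrite mem_iota size_cat size_iota /=; lia.
- by rewrite /= take_size_cat ?drop_size_cat.
Qed.

Lemma cuts_uniq b n : uniq (cuts b n).
Proof.
apply: allpairs_uniq; rewrite ?permutations_uniq ?iota_uniq //.
move=> p q /allpairsP[[s k] [sP kP ->]] /allpairsP[[s' k'] [sP' kP' ->]] [/= e1 e2].
have es : s = s' by rewrite -(cat_take_drop k s) -(cat_take_drop k' s') e1 e2.
rewrite -es in e1 *; congr pair; move/(congr1 size): e1.
rewrite mem_permutations in sP; move: kP kP' (perm_size sP).
by rewrite !mem_iota !size_take size_iota /=; do 2!case: ifP; lia.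
Qed.

Definition objects (P : rel (seq nat)) b n := [seq z <- cuts b n | P z.1 z.2].

Definition count_objects P n := size (objects P 0 n).

Definition shift_invariant (P : rel (seq nat)) :=
  forall k L R, P (map (addn k) L) (map (addn k) R) = P L R.

Lemma mem_objects (P : rel (seq nat)) b n z :
  reflect (P z.1 z.2 /\ onto b n (z.1 ++ z.2)) (z \in objects P b n).
Proof.
by rewrite mem_filter; apply: (iffP andP) => -[? /mem_cuts].
Qed.

Lemma objects_uniq P b n : uniq (objects P b n).
Proof. by rewrite filter_uniq ?cuts_uniq. Qed.

Lemma onto_shift b n s : onto 0 n s -> onto b n (map (addn b) s).
Proof.
move=> [us ms]; split=> [|v]; first by rewrite (map_inj_uniq (@addnI b)).
apply/mapP/idP => [[w + ->]|vP]; rewrite ?ms; first lia.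
by exists (v - b); rewrite ?ms; lia.
Qed.

Lemma onto_unshift b n s : onto b n s ->
  onto 0 n (map (subn^~ b) s) /\ map (addn b) (map (subn^~ b) s) = s.
Proof.
move=> [us ms]; have e : map (addn b) (map (subn^~ b) s) = s.
  rewrite -map_comp; apply: map_id_in => v /=; rewrite ms; lia.
split=> //; split=> [|v]; first by rewrite -(map_inj_uniq (@addnI b)) e.
by rewrite -(mem_map (@addnI b)) e ms; lia.
Qed.

(** Translation by [b] is a bijection. It lets factors living on higher intervals of values be
    counted by [count_objects]. *)
Lemma size_objects P b n : shift_invariant P -> size (objects P b n) = count_objects P n.
Proof.
move=> P_shift; pose f (z : seq nat * seq nat) := (map (addn b) z.1, map (addn b) z.2).
apply: (@size_bijection _ _ f); rewrite ?objects_uniq //.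
- move=> z /mem_objects[Pz oz]; apply/mem_objects.
  by rewrite /= P_shift -map_cat; split=> //; apply: onto_shift.
- case=> L R /mem_objects /= [PLR oLR]; have [o e] := onto_unshift oLR.
  exists (map (subn^~ b) L, map (subn^~ b) R).
    apply/mem_objects => /=; move: e; rewrite !map_cat => /eqP.
    rewrite eqseq_cat ?size_map // => /andP[/eqP e1 /eqP e2].
    by rewrite -(P_shift b) e1 e2 -map_cat.
  move: e; rewrite !map_cat => /eqP; rewrite eqseq_cat ?size_map // => /andP[/eqP e1 /eqP e2].
  by rewrite /f /= e1 e2.
- move=> [L R] [L' R'] _ _ [e1 e2].
  by rewrite (inj_map (@addnI b) e1) (inj_map (@addnI b) e2).
Qed.

Lemma count_objects_split (P Q : rel (seq nat)) n :
  count_objects P n = count_objects (fun L R => P L R && Q L R) n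
                      + count_objects (fun L R => P L R && ~~ Q L R) n.
Proof.
rewrite /count_objects /objects !size_filter.
elim: (cuts 0 n) => //= z s ->; case: (P _ _) => //=; case: (Q _ _) => /=; lia.
Qed.

(** * Forbidden patterns *)

(** The first alternative is the pattern 4312, the second 3142. *)
Definition bad_quad (a b c d : nat) := [&& c < d, d < b & b < a] || [&& b < d, d < a & a < c].

(** The last case makes every nonempty subsequence of L bad, which forces L to be empty. *)
Definition bad_word (t u : seq nat) : bool :=
  match t, u with
  | [::], [:: a; b; c; d] => bad_quad a b c d
  | [::], _ => false
  | _ :: _, _ => true
  end.

(* The patterns to be avoided in L and R for L n R to avoid 4312 and 3142, where n
   exceeds all entries of L and R. *)
Definition bad_max (t u : seq nat) : bool :=
  match t, u with
  | [:: a; b; c; d], [::] => bad_quad a b c d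
  | [:: c; a], [:: b] => a < b < c
  | [:: d; c], [:: a; b] => [&& a < b, b < c & c < d]
  | [:: c], [:: a; d; b] => [&& a < b, b < c & c < d]
  | [::], [:: c; a; b] => a < b < c
  | _, _ => false
  end.

(** The condition on (LQ, Q): it is what [bad_max] imposes on LQ and r Q, where r is below all other
    entries and the minimum of LQ Q lies in Q. *)
Definition bad_incr (t u : seq nat) : bool :=
  match t, u with
  | [:: b; a], [::] => a < b
  | [:: b], [:: c; a] => a < b < c
  | [::], [:: c; a; b] => a < b < c
  | _, _ => false
  end.

Lemma bad_word_shift k t u : bad_word (map (addn k) t) (map (addn k) u) = bad_word t u.
Proof.
by case: t => [|? ?] //; case: u => [|? [|? [|? [|? [|? ?]]]]] //=;
  rewrite /bad_quad !ltn_add2l.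
Qed.

Lemma bad_max_shift k t u : bad_max (map (addn k) t) (map (addn k) u) = bad_max t u.
Proof.
by case: t => [|? [|? [|? [|? [|? ?]]]]]; case: u => [|? [|? [|? [|? ?]]]] //=;
  rewrite /bad_quad !ltn_add2l.
Qed.

Lemma bad_incr_shift k t u : bad_incr (map (addn k) t) (map (addn k) u) = bad_incr t u.
Proof.
by case: t => [|? [|? [|? ?]]]; case: u => [|? [|? [|? [|? ?]]]] //=; rewrite !ltn_add2l.
Qed.

Lemma sub_all_subseq (p : pred nat) (t s : seq nat) : subseq t s -> all p s -> all p t.
Proof. by move=> /mem_subseq ts /allP ps; apply/allP=> x /ts/ps. Qed.

Lemma subseq_consP (x : nat) (t s : seq nat) : subseq t (x :: s) ->
  subseq t s \/ exists2 t', t = x :: t' & subseq t' s.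
Proof.
case: t => [|y t] /=; first by left; apply: sub0seq.
by case: eqP => [->|_] ?; [right; exists t | left].
Qed.

(** Distributes an occurrence over the factors of a concatenation. Patterns have at most four
    entries, so enumerating the length of each part leaves explicit lists and goals in linear
    arithmetic. *)
Ltac split_subseq := repeat match goal with
  | H : is_true (@subseq _ _ (@cat _ _ _)) |- _ =>
      let t1 := fresh "t" in let e := fresh "e" in let H1 := fresh "H" in
      case: (subseq_catP H) => {H} t1 [? [e H1 ?]];
      case: t1 e H1 => [|? [|? [|? [|? [|? ?]]]]] //= e H1;
      try (case: e => * ); subst; try discriminate
  | H : is_true (@subseq _ _ (@cons _ _ _)) |- _ =>
      let e := fresh "e" in
      case: (subseq_consP H) => {H} [?|[? e ?]]; [|try (case: e => * ); subst; try discriminate]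
  end.

(** Every [bad_max] pair contains a [bad_incr] pair: two or more entries in L start with an
    inversion, and from [[:: c], [:: a; d; b]] it suffices to drop [a]. *)
Lemma bad_incr_max L R : avoid2 bad_incr L R -> avoid2 bad_max L R.
Proof.
move=> /avoid2P h; apply/avoid2P.
have sub1 (x y : nat) s t : subseq (x :: y :: t) s -> subseq [:: x; y] s.
  by apply: subseq_trans; rewrite /= !eqxx sub0seq.
have sub2 (x : nat) s t : subseq (x :: t) s -> subseq t s.
  by apply: subseq_trans; apply: subseq_cons.
case=> [|a [|b [|c [|d [|? ?]]]]]; case=> [|x [|y [|z [|? ?]]]] //= tL uR.
- exact: (h _ _ tL uR).
- have := h _ _ tL (sub2 _ _ _ uR); rewrite /=; lia.
- have := h _ _ tL (sub0seq _); rewrite /=; lia.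
- have := h _ _ tL (sub0seq _); rewrite /=; lia.
- have := h _ _ (sub1 _ _ _ _ tL) (sub0seq _); rewrite /= /bad_quad; lia.
Qed.

(** A bad pair either lies within one of L0, (LP, P), (LQ, Q), or contradicts the order of these
    bands in value, or leaves a [bad_incr] pair in (LQ, Q) once its entries outside that band are
    dropped. The last case is why (LQ, Q) must satisfy the stronger condition. *)
Lemma avoid_max_cat L0 LP LQ P Q r hi :
    all (fun v => v < r) L0 -> all (fun v => r < v < hi) LP -> all (fun v => r < v < hi) P ->
    all (fun v => hi <= v) LQ -> all (fun v => hi <= v) Q -> r < hi ->
    avoid2 bad_word [::] L0 -> avoid2 bad_max LP P -> avoid2 bad_incr LQ Q ->
  avoid2 bad_max (L0 ++ LP ++ LQ) (P ++ r :: Q).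
Proof.
move=> aL0 aLP aP aLQ aQ lt_rhi /avoid2P h0 /avoid2P hP hQ.
have /avoid2P hQ' := bad_incr_max hQ; move/avoid2P: hQ => hQ.
apply/avoid2P => t u tL uR; apply/negP.
case: t tL => [|a [|b [|c [|d [|? ?]]]]] tL; case: u uR => [|x [|y [|z [|? ?]]]] uR //= bad;
split_subseq;
match goal with H0 : is_true (@subseq _ ?t0 L0),
  HtP : is_true (@subseq _ ?tP LP), HuP : is_true (@subseq _ ?uP P),
  HtQ : is_true (@subseq _ ?tQ LQ), HuQ : is_true (@subseq _ ?uQ Q) |- _ =>
  move: (sub_all_subseq H0 aL0) (sub_all_subseq HtP aLP) (sub_all_subseq HuP aP)
    (sub_all_subseq HtQ aLQ) (sub_all_subseq HuQ aQ);
  first [move=> /= _ _ _ _ _; have := h0 [::] t0 isT H0; rewrite /= bad; done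
        |move=> /= _ _ _ _ _; have := hP _ _ HtP HuP; rewrite /= bad; done
        |move=> /= _ _ _ _ _; have := hQ' _ _ HtQ HuQ; rewrite /= bad; done
        |move: bad; rewrite /= /bad_quad; clear -lt_rhi; lia
        |move: (hQ _ _ HtQ HuQ) (hQ _ _ HtQ (sub0seq _)) bad; rewrite /= /bad_quad;
         clear -lt_rhi; lia]
end.
Qed.

(** In an occurrence the maximum [n] can only play the 4, which gives 312 in R or the pair 31, 2. An
    occurrence without [n], cut into its parts in L and R, contains a [bad_max] pair. Conversely a
    bad pair (t, u) makes an occurrence of t u or of t n u. *)
Lemma avoid_word_max L R n : all (fun v => v < n) L -> all (fun v => v < n) R ->
  avoid2 bad_word [::] (L ++ n :: R) = avoid2 bad_max L R.
Proof.
move=> aL aR; apply/avoid2P/avoid2P => h t u.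
  move=> tL uR; have bL := sub_all_subseq tL aL; have bR := sub_all_subseq uR aR.
  have h1 : ~~ bad_word [::] (t ++ u).
    by apply: h => //; apply: cat_subseq => //; apply: subseq_trans uR (subseq_cons _ _).
  have h2 : ~~ bad_word [::] (t ++ n :: u).
    by apply: h => //; apply: cat_subseq => //=; rewrite eqxx.
  move: t u bL bR h1 h2 {tL uR} => [|a [|b [|c [|d [|? ?]]]]] [|x [|y [|z [|? ?]]]] //=;
    rewrite /bad_quad; clear; lia.
rewrite subseq0 => /eqP-> {t}; case: u => [|a [|b [|c [|d [|? ?]]]]] // uR; apply/negP => /= bad.
split_subseq; match goal with HL : is_true (@subseq _ ?t L), HR : is_true (@subseq _ ?u R) |- _ =>
  (* The masks extract the smaller bad pairs inside an occurrence, for example 3, 1, 2 from a 3142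
     lying in R. *)
  have hL m := h _ _ (subseq_trans (mask_subseq m t) HL) HR;
  have hR m := h _ _ (sub0seq _) (subseq_trans (mask_subseq m u) HR);
  move: (h _ _ HL (subseq_trans (mask_subseq [:: false; true] u) HR));
  move: (h _ _ HL HR) (sub_all_subseq HL aL) (sub_all_subseq HR aR)
    (hL [:: true; true]) (hL [:: false; true; true])
    (hR [:: true; true; true]) (hR [:: false; true; true; true]) (hR [:: true; true; false; true]);
  move: bad; rewrite /= /bad_quad; clear; lia
  end.
Qed.

(** * Words on intervals of values and their cuts *)

Lemma onto_bound b n s : onto b n s -> all (fun v => b <= v < b + n) s.
Proof. by move=> [_ ms]; apply/allP => v; rewrite ms. Qed.

Lemma onto_perm b n s t : perm_eq s t -> onto b n s -> onto b n t.
Proof.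
by move=> st [us ms]; split=> [|v]; rewrite -?(perm_uniq st) // -(perm_mem st) ms.
Qed.

Lemma onto_size b n s : onto b n s -> size s = n.
Proof. by move=> /perm_iotaP/perm_size ->; rewrite size_iota. Qed.

Lemma onto1 r : onto r 1 [:: r].
Proof. by apply/perm_iotaP. Qed.

Lemma onto_cat b m n s t : onto b m s -> onto (b + m) n t -> onto b (m + n) (s ++ t).
Proof.
move=> /perm_iotaP sP /perm_iotaP tP; apply/perm_iotaP.
by rewrite iotaD perm_cat.
Qed.

Lemma onto_catI b n k s t : onto b n (s ++ t) -> b <= k <= b + n ->
  all (fun v => v < k) s -> all (fun v => k <= v) t ->
  onto b (k - b) s /\ onto k (b + n - k) t.
Proof.
move=> [+ ms] bk /allP sk /allP tk; rewrite cat_uniq => /and3P[us _ ut].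
by split; split=> // v; have := ms v; have := sk v; have := tk v; rewrite mem_cat;
  case: (v \in s); case: (v \in t) => /= Ht Hs; try (have := Ht isT); try (have := Hs isT); lia.
Qed.

Lemma cat_cons_inj (T : eqType) (x : T) s t s' t' : x \notin s -> x \notin s' ->
  s ++ x :: t = s' ++ x :: t' -> s = s' /\ t = t'.
Proof.
elim: s s' => [|y s IHs] [|y' s'] //=; rewrite ?inE ?negb_or.
- by move=> _ _ [->].
- by move=> _ /andP[/eqP ne _] [/ne].
- by move=> /andP[/eqP ne _] _ [/esym/ne].
- by move=> /andP[_ xs] /andP[_ xs'] [-> /(IHs _ xs xs')[-> ->]].
Qed.

(** Filtering by the threshold recovers both factors from the concatenation. *)
Lemma cat_threshold_inj k s t s' t' :
  all (fun v => v < k) s -> all (fun v => k <= v) t ->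
  all (fun v => v < k) s' -> all (fun v => k <= v) t' ->
  s ++ t = s' ++ t' -> s = s' /\ t = t'.
Proof.
have filt u v : all (fun x => x < k) u -> all (fun x => k <= x) v ->
    filter (fun x => x < k) (u ++ v) = u /\ filter (fun x => k <= x) (u ++ v) = v.
  move=> uP vP; rewrite !filter_cat (all_filterP uP) (all_filterP vP).
  have -> : filter (fun x => x < k) v = [::].
    by apply/eqP; rewrite -[_ == _]negbK -has_filter -all_predC; apply: sub_all vP => x /=; lia.
  have -> : filter (fun x => k <= x) u = [::].
    by apply/eqP; rewrite -[_ == _]negbK -has_filter -all_predC; apply: sub_all uP => x /=; lia.
  by rewrite cats0.
move=> /filt h {}/h [e1 e2] /filt h' {}/h' [e1' e2'] e.
by split; [rewrite -e1 e e1' | rewrite -e2 e e2'].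
Qed.

(** The hypothesis holds when [k] is an entry of R and no inversion of L straddles it; this produces
    the factors L0, LP, LQ. *)
Lemma cat_threshold k L : (forall x y, subseq [:: x; y] L -> k <= x -> k <= y) ->
  exists L1 L2, [/\ L = L1 ++ L2, all (fun v => v < k) L1 & all (fun v => k <= v) L2].
Proof.
elim: L => [|x L IHL] h; first by exists [::], [::].
case: (leqP k x) => kx.
  exists [::], (x :: L); split=> //=; rewrite kx; apply/allP=> y yL.
  by apply: (h x) => //=; rewrite eqxx sub1seq.
have [y z yz|L1 [L2 [-> aL1 aL2]]] := IHL.
  by apply: h; apply: subseq_trans yz (subseq_cons _ _).
by exists (x :: L1), L2; rewrite /= kx.
Qed.

Lemma seq_min (s : seq nat) : s != [::] -> exists2 r, r \in s & all (leq r) s.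
Proof.
elim: s => // x [|y s] IHs _; first by exists x; rewrite ?inE //= leqnn.
have [//|r rs rP] := IHs; case: (leqP x r) => xr.
  exists x; rewrite ?inE ?eqxx //= leqnn; apply: sub_all rP => z; exact: leq_trans.
by exists r; [rewrite inE rs orbT | rewrite [all _ _]/= (ltnW xr)].
Qed.

Lemma nil_of_bad_word T w : avoid2 bad_word T w -> T = [::].
Proof.
by case: T => // x T /avoid2P/(_ [:: x] [::]) /=; rewrite eqxx => /(_ (sub0seq _) (sub0seq _)).
Qed.

(** * Recurrences from the decompositions *)

(** This is A = 1 + xG in coefficients: inserting the maximum [n] at the cut is a bijection. *)
Lemma count_word_max n : count_objects (avoid2 bad_word) n.+1 = count_objects (avoid2 bad_max) n.
Proof.
pose f (z : seq nat * seq nat) : seq nat * seq nat := ([::], z.1 ++ n :: z.2).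
have bound L R : onto 0 n (L ++ R) -> all (fun v => v < n) L /\ all (fun v => v < n) R.
  by move=> /onto_bound; rewrite add0n all_cat => /andP.
apply: (@size_bijection _ _ f); rewrite ?objects_uniq //.
- case=> L R /mem_objects /= [LR oLR]; have [aL aR] := bound _ _ oLR.
  apply/mem_objects; rewrite /= avoid_word_max //; split=> //.
  apply: (@onto_perm _ _ ((L ++ R) ++ [:: n])).
    by apply/seq.permP => a; rewrite !count_cat /= addn0; lia.
  by rewrite -addn1; apply: onto_cat oLR _; rewrite add0n; apply: onto1.
- case=> T w /mem_objects /= [Tw oTw].
  have eT := nil_of_bad_word Tw; rewrite eT /= in Tw oTw *.
  have nw : n \in w by case: oTw => _ ->; lia.
  case/splitPr: w / nw Tw oTw => L R Tw oTw.
  have [oLR _] : onto 0 (n - 0) (L ++ R) /\ onto n (0 + n.+1 - n) [:: n].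
    have oT : onto 0 n.+1 ((L ++ R) ++ [:: n]).
      by apply: onto_perm oTw; apply/seq.permP => a; rewrite !count_cat /= addn0; lia.
    apply: (onto_catI oT) => //=; rewrite ?leqnn //.
    apply/allP => v vLR; have [us ms] := oT; have := ms v; rewrite mem_cat vLR /=.
    move: us; rewrite cat_uniq /= orbF => /and3P[_ vn _].
    have : v != n by apply: contraNneq vn => <-.
    lia.
  rewrite subn0 in oLR; have [aL aR] := bound _ _ oLR.
  by exists (L, R); rewrite /f //= ?eT //; apply/mem_objects; rewrite /= -(avoid_word_max aL aR).
- case=> L R [L' R'] /mem_objects /= [_ oLR] /mem_objects /= [_ oLR'] [/cat_cons_inj e].
  have no s t : onto 0 n (s ++ t) -> n \notin s.
    by move=> /bound[/allP h _]; apply/negP => /h; rewrite ltnn.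
  by have [-> ->] := e (no _ _ oLR) (no _ _ oLR').
Qed.

(* [incr_class true] encodes the 312-avoiding words, c in the header, while
   [incr_class false] and [low_incr_class false] are K and C. *)
Definition incr_class (only_R : bool) (L R : seq nat) : bool :=
  avoid2 bad_incr L R && (only_R ==> nilp L).

(** For distinct entries this says that the minimum of L and R together lies in R. It also holds of
    the empty pair, which gives C its constant term 1. *)
Definition low_R (L R : seq nat) : bool := all (fun l => has (ltn^~ l) R) L.

Definition low_incr_class e (L R : seq nat) := incr_class e L R && low_R L R.

Lemma avoid2_shift bad : (forall k t u, bad (map (addn k) t) (map (addn k) u) = bad t u) ->
  shift_invariant (avoid2 bad).
Proof. by move=> bad_k k L R; apply: avoid2_map. Qed.

Lemma incr_shift e : shift_invariant (incr_class e).
Proof. by move=> k L R; rewrite /incr_class (avoid2_shift bad_incr_shift) /nilp size_map. Qed.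

Lemma low_incr_shift e : shift_invariant (low_incr_class e).
Proof.
move=> k L R; rewrite /low_incr_class incr_shift /low_R all_map; congr (_ && _).
by apply: eq_all => l /=; rewrite has_map; apply: eq_has => v /=; rewrite ltn_add2l.
Qed.

Lemma avoid2_sub bad L R L' R' : subseq L' L -> subseq R' R ->
  avoid2 bad L R -> avoid2 bad L' R'.
Proof.
move=> sL sR /avoid2P h; apply/avoid2P => t u tL uR.
by apply: h; [apply: subseq_trans tL sL | apply: subseq_trans uR sR].
Qed.

(** Since r < P < m and L, Q are at least m, an entry of P has no smaller entry in L or Q, and r has
    none at all. Hence a bad pair lies inside P or inside (L, Q). *)
Lemma avoid_incr_cat L P Q r m :
    all (fun v => m <= v) L -> all (fun v => r < v < m) P -> all (fun v => m <= v) Q -> r < m ->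
    avoid2 bad_incr [::] P -> avoid2 bad_incr L Q ->
  avoid2 bad_incr L (P ++ r :: Q).
Proof.
move=> aL aP aQ lt_rm /avoid2P hP /avoid2P hQ; apply/avoid2P => t u tL uR; apply/negP.
case: t tL => [|a [|b [|? ?]]] tL; case: u uR => [|x [|y [|z [|? ?]]]] uR //= bad; split_subseq;
match goal with HL : is_true (@subseq _ ?t L), HP : is_true (@subseq _ ?p P), HQ : is_true (@subseq _ ?q Q) |- _ =>
  move: (sub_all_subseq HL aL) (sub_all_subseq HP aP) (sub_all_subseq HQ aQ)
    (hP [::] p isT HP) (hQ _ _ HL HQ); move: bad; rewrite /=; clear -lt_rm; lia
end.
Qed.

Lemma mem_low_R e b n L R : onto b n.+1 (L ++ R) -> low_incr_class e L R -> b \in R.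
Proof.
move=> [_ ms] /andP[_ /allP low]; have := ms b; rewrite mem_cat.
case bL : (b \in L) => /=; last by rewrite leqnn addnS ltnS leq_addr.
have /hasP[v vR vb] := low _ bL; have := ms v; rewrite mem_cat vR orbT /=.
by move: vb; rewrite /=; lia.
Qed.

Lemma subseq_around (T : eqType) (s1 s2 : seq T) (x r y : T) :
  x \in s1 -> y \in s2 -> subseq [:: x; r; y] (s1 ++ r :: s2).
Proof.
move=> xs ys; rewrite -[[:: x; r; y]]/([:: x] ++ [:: r; y]); apply: cat_subseq.
  by rewrite sub1seq.
by rewrite /= eqxx sub1seq.
Qed.

Lemma onto_cat_lt b n s t : onto b n (s ++ t) ->
  (forall x y, x \in s -> y \in t -> x < y) ->
  onto b (size s) s /\ onto (b + size s) (n - size s) t.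
Proof.
move=> o lt_st.
(* The threshold is the minimum of [t], or the end of the interval when [t] is empty. *)
have [k [kb ks kt]] : exists k, [/\ b <= k <= b + n, all (fun v => v < k) s & all (fun v => k <= v) t].
  have := onto_bound o; rewrite all_cat => /andP[/allP bs /allP bt].
  case: (eqVneq t [::]) => [-> | /seq_min[k kt mt]].
    by exists (b + n); rewrite leq_addr leqnn; split=> //; apply/allP => v /bs; lia.
  by exists k; split=> //; [have := bt _ kt; lia | apply/allP => v /lt_st -> ].
have [os ot] := onto_catI o kb ks kt; have := onto_size os => es.
have ek : k = b + size s by lia.
by move: os ot; rewrite -es ek subnDl.
Qed.

(** For [e = false] this is C = 1 + xcK; for [e = true] it leads to c = 1 + xc^2. The minimum 0 lies
    in R = P 0 Q. Avoiding 312 puts P below Q, and no entry of L lies between x and 0 for x in P, so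
    P is also below L. Thus P is a 312-avoider on the values 1, ..., i, and (L, Q) is any pair of
    the class on the rest. *)
Lemma count_low_incr e n : count_objects (low_incr_class e) n.+1 =
  \sum_(i < n.+1) count_objects (incr_class true) i * count_objects (incr_class e) (n - i).
Proof.
pose f (_ : nat) (z : (seq nat * seq nat) * (seq nat * seq nat)) := (z.2.1, z.1.2 ++ 0 :: z.2.2).
pose X i := [seq (x, y) | x <- objects (incr_class true) 1 i,
                          y <- objects (incr_class e) (1 + i) (n - i)].
have memX i x : x \in X i -> [/\ x.1.1 = [::], avoid2 bad_incr [::] x.1.2,
    onto 1 i x.1.2, incr_class e x.2.1 x.2.2 & onto (1 + i) (n - i) (x.2.1 ++ x.2.2)].
  case/allpairsP=> -[[T P] [L Q]] [/mem_objects /= [/andP[aP /nilP e1] oP] /mem_objects /= [aQ oQ] ->].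
  by rewrite /= e1 /= in aP oP *.
transitivity (\sum_(i <- index_iota 0 n.+1) size (X i)); last first.
  rewrite big_mkord; apply: eq_bigr => i _.
  by rewrite size_allpairs !size_objects //; apply: incr_shift.
apply: (@size_decomposition _ _ _ _ X f); rewrite ?objects_uniq ?iota_uniq //.
- by move=> i _; apply: allpairs_uniq; rewrite ?objects_uniq // => -[? ?] [? ?].
- move=> i x; rewrite mem_index_iota => lei /memX [_ aP oP /andP[aQ eL] oQ].
  have /allP bP := onto_bound oP; have bQ := onto_bound oQ.
  move: bQ; rewrite all_cat => /andP[bL bQ].
  apply/mem_objects; split=> /=; last first.
    apply: (@onto_perm _ _ ([:: 0] ++ (x.1.2 ++ (x.2.1 ++ x.2.2)))).
      by apply/seq.permP => a; rewrite !count_cat /=; lia.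
    rewrite -add1n; apply: onto_cat (onto1 0) _.
    have e' : i + (n - i) = n by lia.
    by rewrite -[X in onto _ X _]e'; apply: onto_cat.
  rewrite /low_incr_class /incr_class eL andbT; apply/andP; split.
    apply: (@avoid_incr_cat _ _ _ _ (1 + i)) => //.
    + by apply: sub_all bL => v /=; lia.
    + by apply/allP=> v /bP /=; lia.
    + by apply: sub_all bQ => v /=; lia.
  apply: sub_all bL => v /= bv; apply/hasP; exists 0; last by rewrite /=; lia.
  by rewrite mem_cat inE eqxx orbT.
- case=> L R /mem_objects /= [LR oLR].
  have R0 := mem_low_R oLR LR; case/andP: LR => /andP[aLR eL] _.
  case/splitPr: R / R0 aLR oLR => P Q aLR oLR.
  have oLR' : onto 0 n.+1 ([:: 0] ++ (P ++ (L ++ Q))).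
    by apply: onto_perm oLR; apply/seq.permP => a; rewrite !count_cat /=; lia.
  have pos : all (fun v => 0 < v) (P ++ (L ++ Q)).
    case: oLR' => /= /andP[n0 _] _; apply/allP => -[|//] v0; by rewrite v0 in n0.
  have [_] := onto_catI (k := 1) oLR' isT isT pos; rewrite add0n subn1 /= => o1.
  have us : uniq (P ++ L ++ Q) by case: o1.
  have Pmin x y : x \in P -> y \in L ++ Q -> x < y.
    move=> xP yLQ; have ne : x != y.
      apply: contraTneq us => exy; rewrite cat_uniq; apply/negP=> /and3P[_ /hasP[]].
      by exists y => //; rewrite -exy.
    have x0 : 0 < x by apply: (allP pos); rewrite mem_cat xP.
    have y0 : 0 < y by apply: (allP pos); rewrite mem_cat yLQ orbT.
    move: yLQ; rewrite mem_cat => /orP[yL|yQ].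
      have s0 : subseq [:: x; 0] (P ++ 0 :: Q).
        by rewrite -[[:: x; 0]]/([:: x] ++ [:: 0]); apply: cat_subseq; rewrite sub1seq ?mem_head.
      have s1 : subseq [:: y] L by rewrite sub1seq.
      by have /avoid2P/(_ _ _ s1 s0) /= := aLR; lia.
    have /avoid2P/(_ [::] [:: x; 0; y] (sub0seq _) (subseq_around _ xP yQ)) /= := aLR; lia.
  have lei : size P <= n by rewrite -(onto_size o1) size_cat leq_addr.
  have [oP oLQ] := onto_cat_lt o1 Pmin.
  exists (size P), (([::], P), (L, Q)); split=> //; first by rewrite mem_index_iota ltnS.
  apply/allpairsP; exists (([::], P), (L, Q)); split=> //; apply/mem_objects => /=; split=> //.
    by rewrite /incr_class andbT; apply: avoid2_sub aLR; [apply: sub0seq | apply: prefix_subseq].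
  rewrite /incr_class eL andbT; apply: avoid2_sub aLR => //.
  by apply: subseq_trans (subseq_cons _ 0) (suffix_subseq _ _).
- move=> i [[T P] [L Q]] j [[T' P'] [L' Q']] _ /memX /= [-> _ oP _ _] _ /memX /= [-> _ oP' _ _].
  have no k s : onto 1 k s -> 0 \notin s by case=> _ ms; rewrite ms.
  move=> [-> /(cat_cons_inj (no _ _ oP) (no _ _ oP'))[eP ->]].
  by rewrite -(onto_size oP) -(onto_size oP') eP.
Qed.

(** L is empty here, so [low_R] is vacuous; this closes the recurrence for c. *)
Lemma count_incr_true n : count_objects (low_incr_class true) n = count_objects (incr_class true) n.
Proof.
rewrite /count_objects /objects; congr size; apply: eq_filter => -[L R] /=.
rewrite /low_incr_class /incr_class /=; case: avoid2 => //=.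
by case: L.
Qed.

(** This is K = C + xK. When [low_R] fails the minimum is in L, and it comes first because L is
    increasing; deleting it leaves an arbitrary pair of K. *)
Lemma count_incr n : count_objects (incr_class false) n.+1 =
  count_objects (low_incr_class false) n.+1 + count_objects (incr_class false) n.
Proof.
rewrite (count_objects_split _ low_R); congr addn.
rewrite -(size_objects 1 n (incr_shift false)).
pose f (z : seq nat * seq nat) := (0 :: z.1, z.2).
apply: (@size_bijection _ _ f); rewrite ?objects_uniq //.
- case=> L R /mem_objects /= [/andP[/avoid2P aLR _] oLR].
  have := onto_bound oLR; rewrite all_cat => /andP[bL bR].
  apply/mem_objects; split=> /=; last first.
    by rewrite -cat1s -add1n; apply: onto_cat (onto1 0) oLR.
  apply/andP; split; last by rewrite negb_and; apply/orP; left; apply/hasPn.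
  rewrite /incr_class andbT; apply/avoid2P => t u tL uR; apply/negP.
  case: t tL => [|a [|b [|? ?]]] tL; case: u uR => [|x [|y [|z [|? ?]]]] uR //= bad; split_subseq;
  match goal with HL : is_true (@subseq _ ?t L), HR : is_true (@subseq _ ?u R) |- _ =>
    move: (sub_all_subseq HL bL) (sub_all_subseq HR bR) (aLR _ _ HL HR); move: bad; rewrite /=; clear; lia
  end.
- case=> L R /mem_objects /= [/andP[LR nlow] oLR].
  have [l lL nl] : exists2 l, l \in L & forall q, q \in R -> l <= q.
    by have /allPn[l lL /hasPn nl] := nlow; exists l => // q /nl; rewrite -leqNgt.
  have [us ms] := oLR.
  have L0 : 0 \in L.
    have := ms 0; rewrite mem_cat => /orP[//|/nl]; rewrite leqn0 => /eqP e; by rewrite -e.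
  case/splitPr: L / L0 us LR oLR {ms nlow lL} => L1 L2 us LR oLR.
  have L10 : L1 = [::].
    case: L1 us LR oLR => // x L1 us /andP[/avoid2P aLR _] _.
    have /(aLR _ [::])/(_ (sub0seq _)) /= : subseq [:: x; 0] (x :: L1 ++ 0 :: L2).
      by rewrite /= eqxx sub1seq mem_cat mem_head orbT.
    move: us => /= /andP[+ _]; rewrite !mem_cat inE !negb_or; case: (x) => //=.
    by rewrite andbF.
  rewrite L10 /= in LR oLR us *.
  exists (L2, R) => //; apply/mem_objects; split=> /=.
    case/andP: LR => aLR _; rewrite /incr_class andbT; apply: avoid2_sub aLR => //.
    exact: subseq_cons.
  have pos : all (fun v => 0 < v) (L2 ++ R).
    by apply/allP => -[|//] h0; move: us; rewrite h0.
  by have [_] := @onto_catI 0 n.+1 1 [:: 0] (L2 ++ R) oLR isT isT pos; rewrite add0n subn1.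
- by case=> L R [L' R'] _ _ [-> ->].
Qed.

Lemma avoid_max_nil L : avoid2 bad_max L [::] = avoid2 bad_word [::] L.
Proof.
apply/avoid2P/avoid2P => h t u; rewrite ?subseq0.
  move=> /eqP-> uL; have := h _ _ uL (sub0seq _).
  by case: u {uL} => [|? [|? [|? [|? [|? ?]]]]].
move=> tL /eqP->; have := h _ _ (sub0seq _) tL.
by case: t {tL} => [|? [|? [|? [|? [|? ?]]]]].
Qed.

(** These pairs, with R empty, give the term A of G = A + xAGC. *)
Lemma count_max_nil n :
  count_objects (fun L R => avoid2 bad_max L R && nilp R) n = count_objects (avoid2 bad_word) n.
Proof.
pose f (z : seq nat * seq nat) : seq nat * seq nat := (z.2, [::]).
apply: (@size_bijection _ _ f); rewrite ?objects_uniq //.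
- case=> T w /mem_objects /= [aw ow]; have eT := nil_of_bad_word aw; rewrite eT in aw ow.
  by apply/mem_objects; rewrite /= avoid_max_nil aw cats0.
- case=> L R /mem_objects /= [/andP[aL /nilP eR] oL]; rewrite eR in aL oL *.
  by exists ([::], L) => //; apply/mem_objects; rewrite /= -avoid_max_nil; rewrite cats0 in oL.
- case=> T w [T' w'] /mem_objects /= [/nil_of_bad_word-> _] /mem_objects /= [/nil_of_bad_word-> _].
  by case=> ->.
Qed.

(** Here [i] is r = min R, and [j] counts the values strictly between r and [hi], the minimum of Q.
    Avoiding 312 around r gives P < Q. No inversion of L straddles r or [hi], so L is cut at these
    two values. *)
Lemma avoid_max_split n L R : onto 0 n.+1 (L ++ R) -> avoid2 bad_max L R -> ~~ nilp R ->
  exists i j L0 LP P LQ Q,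
    [/\ i <= n, j <= n - i, L = L0 ++ LP ++ LQ, R = P ++ i :: Q &
     [/\ avoid2 bad_word [::] L0 /\ onto 0 i L0,
         avoid2 bad_max LP P /\ onto i.+1 j (LP ++ P) &
         low_incr_class false LQ Q /\ onto (i.+1 + j) (n - i - j) (LQ ++ Q)]].
Proof.
move=> oLR /avoid2P aLR; rewrite /nilp size_eq0 => /seq_min[r rR Rmin].
have [us ms] := oLR.
have rn : r < n.+1 by have := ms r; rewrite mem_cat rR orbT.
case/splitPr: R / rR us ms oLR aLR Rmin => P Q us ms oLR aLR Rmin.
have /and3P[_ _ uR] : [&& uniq L, ~~ has (mem L) (P ++ r :: Q) & uniq (P ++ r :: Q)].
  by rewrite -cat_uniq.
have LneR x y : x \in L -> y \in P ++ r :: Q -> x != y.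
  move=> xL yR; apply: contraTneq us => exy; rewrite cat_uniq; apply/negP => /and3P[_ /hasP[]].
  by exists y => //; rewrite -exy.
have ltPQ x y : x \in P -> y \in Q -> [/\ r < x, r < y & x < y].
  move=> xP yQ; have := aLR [::] [:: x; r; y] (sub0seq _) (subseq_around _ xP yQ).
  have : uniq [:: x; r; y].
    exact: subseq_uniq (subseq_around _ xP yQ) uR.
  have : r <= x by apply: (allP Rmin); rewrite mem_cat xP.
  have : r <= y by apply: (allP Rmin); rewrite mem_cat inE yQ !orbT.
  by rewrite /= !inE !negb_or; clear; split; lia.
have gtP x : x \in P -> r < x.
  move=> xP; have : r <= x by apply: (allP Rmin); rewrite mem_cat xP.
  rewrite leq_eqVlt => /orP[/eqP e|//]; move: uR; rewrite cat_uniq => /and3P[_].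
  by rewrite /= e xP.
have gtQ x : x \in Q -> r < x.
  move=> xQ; have : r <= x by apply: (allP Rmin); rewrite mem_cat inE xQ !orbT.
  rewrite leq_eqVlt => /orP[/eqP e|//]; move: uR; rewrite cat_uniq => /and3P[_ _].
  by rewrite /= e xQ.
have rR : r \in P ++ r :: Q by rewrite mem_cat mem_head orbT.
(* When Q is empty, [hi] is [n.+1], above all values, and LQ will be empty too. *)
have [hi [rhi hin Phi Qhi hiQ]] : exists hi, [/\ r < hi, hi <= n.+1, all (fun v => v < hi) P,
    all (fun v => hi <= v) Q & hi = n.+1 \/ hi \in Q].
  case: (eqVneq Q [::]) => [eQ | /seq_min[hi hQ mQ]].
    exists n.+1; rewrite eQ; split=> //; last by left.
    by apply/allP => v vP; have := ms v; rewrite !mem_cat vP orbT.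
  exists hi; split=> //; last by right.
  - exact: gtQ.
  - by have := ms hi; rewrite !mem_cat inE hQ !orbT; clear; lia.
  - by apply/allP => v vP; case: (ltPQ v hi).
have [L0 [L' [eL L0r rL']]] : exists L1 L2, [/\ L = L1 ++ L2, all (fun v => v < r) L1 & all (fun v => r <= v) L2].
  apply: cat_threshold => x y xy; have xL : x \in L by apply: (mem_subseq xy); rewrite mem_head.
  have := LneR _ _ xL rR; have := aLR _ [:: r] xy; rewrite sub1seq rR => /(_ isT) /=.
  by clear; lia.
have [LP [LQ [eL' LPhi hiLQ]]] : exists L1 L2, [/\ L' = L1 ++ L2, all (fun v => v < hi) L1 & all (fun v => hi <= v) L2].
  apply: cat_threshold => x y xy; have xL : x \in L by rewrite eL mem_cat (mem_subseq xy) ?orbT ?mem_head.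
  case: hiQ => [-> | hQ]; first by have := ms x; rewrite mem_cat xL /=; clear; lia.
  have hR : hi \in P ++ r :: Q by rewrite mem_cat inE hQ !orbT.
  have xy' : subseq [:: x; y] L by rewrite eL; apply: subseq_trans xy (suffix_subseq _ _).
  have := LneR _ _ xL hR; have := aLR _ [:: hi] xy'; rewrite sub1seq hR => /(_ isT) /=.
  by clear; lia.
(* In this order the blocks increase in value, so cutting the interval successively at r, r + 1 and
   [hi] gives the values of each block. *)
have o : onto 0 n.+1 (L0 ++ ([:: r] ++ ((LP ++ P) ++ (LQ ++ Q)))).
  by apply: onto_perm oLR; apply/seq.permP => a; rewrite eL eL' !count_cat /=; clear; lia.
have rL x : x \in L' -> r < x.
  move=> xL'; have xL : x \in L by rewrite eL mem_cat xL' orbT.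
  by move: (LneR _ _ xL rR) (allP rL' _ xL'); clear; lia.
have b1 : all (fun v => r < v) (LP ++ P).
  by apply/allP => x; rewrite mem_cat => /orP[xL|/gtP//]; apply: rL; rewrite eL' mem_cat xL.
have b2 : all (fun v => hi <= v) (LQ ++ Q) by rewrite all_cat hiLQ.
have b2' : all (fun v => r < v) (LQ ++ Q) by apply: sub_all b2 => v; apply: leq_trans.
have b1' : all (fun v => v < hi) (LP ++ P) by rewrite all_cat LPhi.
have [o0 {}o] : onto 0 (r - 0) L0 /\ onto r (0 + n.+1 - r) ([:: r] ++ ((LP ++ P) ++ (LQ ++ Q))).
  apply: onto_catI o _ L0r _; first by clear -rn; lia.
  rewrite all_cat /= leqnn; apply/allP => v; rewrite mem_cat => /orP[/(allP b1)|/(allP b2')]; clear; lia.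
have [_ {}o] : onto r (r.+1 - r) [:: r] /\ onto r.+1 (r + (0 + n.+1 - r) - r.+1) ((LP ++ P) ++ (LQ ++ Q)).
  apply: onto_catI o _ _ _; first by clear -rn; lia.
    by rewrite /= ltnSn.
  by rewrite all_cat b1.
have bhi : r.+1 <= hi <= r.+1 + (r + (0 + n.+1 - r) - r.+1) by clear -rhi hin; lia.
have [o1 o2] := onto_catI o bhi b1' b2.
exists r, (hi - r.+1), L0, LP, P, LQ, Q.
have e1 : r.+1 + (hi - r.+1) = hi by clear -rhi hin; lia.
have e2 : n - r - (hi - r.+1) = r.+1 + (r + (0 + n.+1 - r) - r.+1) - hi by clear -rhi hin; lia.
rewrite e1 e2; split=> //; [by clear -rhi hin; lia | by rewrite eL eL' | split; split=> //].
- apply/avoid2P => t u; rewrite subseq0 => /eqP-> uL.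
  have : ~~ bad_max u [::].
    by apply: aLR (sub0seq _); rewrite eL; apply: subseq_trans uL (prefix_subseq _ _).
  by case: u {uL} => [|? [|? [|? [|? [|? ?]]]]].
- by rewrite subn0 in o0.
- move/avoid2P: aLR; apply: avoid2_sub; last exact: prefix_subseq.
  by rewrite eL eL'; apply: subseq_trans (prefix_subseq _ _) (suffix_subseq _ _).
- have sLQ : subseq LQ L by rewrite eL eL' catA suffix_subseq.
  have hiQ' l : l \in LQ -> hi \in Q /\ hi < l.
    move=> lLQ; have lL := mem_subseq sLQ lLQ; have lhi := allP hiLQ _ lLQ.
    case: hiQ => [eh|hQ]; first by have := ms l; rewrite mem_cat lL /=; move: lhi; rewrite eh; clear; lia.
    have ne : l != hi by apply: LneR; rewrite // mem_cat inE hQ !orbT.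
    by split=> //; clear -ne lhi; lia.
  have sub_r u : subseq u Q -> subseq (r :: u) (P ++ r :: Q).
    by move=> uQ; rewrite -[r :: u]cat0s; apply: cat_subseq; rewrite ?sub0seq //= eqxx.
  rewrite /low_incr_class /incr_class andbT; apply/andP; split; last first.
    by apply/allP => l /hiQ'[hQ hl]; apply/hasP; exists hi.
  apply/avoid2P => t u tL uQ; apply/negP.
  have tL' := subseq_trans tL sLQ; have bQ := sub_all_subseq uQ (introT allP gtQ).
  (* A 312 in Q is already bad. The other two [bad_incr] pairs are completed by entries of R:
     [[:: b], [:: c; a]] by r in front of c, and an inversion of LQ by r and [hi], which then form a
     4312 with it. *)
  case: t tL tL' => [|a [|b [|? ?]]] tL tL'; case: u uQ bQ => [|x [|y [|z [|? ?]]]] uQ bQ //= bad.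
  + by have := aLR _ _ tL' (subseq_trans (subseq_cons _ _) (sub_r _ uQ)); rewrite /= bad.
  + by have := aLR _ _ tL' (sub_r _ uQ); move: bad bQ => /=; clear; lia.
  + have /hiQ'[hQ hb] : b \in LQ by apply: (mem_subseq tL); rewrite !inE eqxx orbT.
    have := aLR _ [:: r; hi] tL'; rewrite sub_r ?sub1seq // => /(_ isT) /=.
    by move: bad hb rhi; clear; lia.
Qed.

(** This is G = A + xAGC: R is either empty or split at its minimum. *)
Lemma count_max n : count_objects (avoid2 bad_max) n.+1 =
  count_objects (avoid2 bad_word) n.+1 +
  \sum_(i < n.+1) count_objects (avoid2 bad_word) i *
    \sum_(j < (n - i).+1) count_objects (avoid2 bad_max) j *
                          count_objects (low_incr_class false) (n - i - j).
Proof.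
rewrite (count_objects_split _ (fun _ R => nilp R)) count_max_nil; congr addn.
pose f (p : nat * nat)
    (z : (seq nat * seq nat) * ((seq nat * seq nat) * (seq nat * seq nat))) :=
  (z.1.2 ++ z.2.1.1 ++ z.2.2.1, z.2.1.2 ++ p.1 :: z.2.2.2).
pose I := [seq (i, j) | i <- index_iota 0 n.+1, j <- index_iota 0 (n - i).+1].
pose X (p : nat * nat) := [seq (x, yz) | x <- objects (avoid2 bad_word) 0 p.1,
  yz <- [seq (y, z) | y <- objects (avoid2 bad_max) p.1.+1 p.2,
                      z <- objects (low_incr_class false) (p.1.+1 + p.2) (n - p.1 - p.2)]].
have memI i j : reflect (i <= n /\ j <= n - i) ((i, j) \in I).
  apply: (iffP allpairsPdep) => [[i' [j' [+ + [-> ->]]]]|[lei lej]].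
    by rewrite !mem_index_iota !ltnS.
  by exists i, j; rewrite !mem_index_iota !ltnS.
have memX i j x : x \in X (i, j) -> [/\ x.1.1 = [::],
    avoid2 bad_word [::] x.1.2 /\ onto 0 i x.1.2,
    avoid2 bad_max x.2.1.1 x.2.1.2 /\ onto i.+1 j (x.2.1.1 ++ x.2.1.2) &
    low_incr_class false x.2.2.1 x.2.2.2 /\
    onto (i.+1 + j) (n - i - j) (x.2.2.1 ++ x.2.2.2)].
  case/allpairsP=> -[[T w] yz] [/mem_objects /= [aw ow] /allpairsP[[y z] /= [yP zP ->]] ->] /=.
  have eT := nil_of_bad_word aw; rewrite eT in aw ow *.
  by split=> //; [move/mem_objects: yP | move/mem_objects: zP].
transitivity (\sum_(p <- I) size (X p)); last first.
  rewrite big_allpairs_dep big_mkord; apply: eq_bigr => i _.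
  rewrite big_mkord big_distrr; apply: eq_bigr => j _ /=.
  have [sw sm sl] := And3 (avoid2_shift bad_word_shift) (avoid2_shift bad_max_shift) (low_incr_shift false).
  by rewrite !size_allpairs !size_objects.
apply: (@size_decomposition _ _ _ I X f); rewrite ?objects_uniq //.
- by apply: allpairs_uniq_dep => [|i _|[? ?] [? ?] _ _ /= [-> ->]]; rewrite ?iota_uniq.
- move=> p _; apply: allpairs_uniq; rewrite ?objects_uniq //; last by move=> [? ?] [? ?].
  by apply: allpairs_uniq; rewrite ?objects_uniq // => -[? ?] [? ?].
- case=> i j x /memI[lei lej] /memX[_ [aw ow] [ay oy] [/andP[/andP[az _] _] oz]].
  have := onto_bound oy; rewrite all_cat => /andP[bLP bP].
  have := onto_bound oz; rewrite all_cat => /andP[bLQ bQ].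
  apply/mem_objects; split=> /=; last first.
    apply: (@onto_perm _ _ (x.1.2 ++ ([:: i] ++ ((x.2.1.1 ++ x.2.1.2) ++ (x.2.2.1 ++ x.2.2.2))))).
      by apply/seq.permP => a; rewrite !count_cat /=; clear; lia.
    have -> : n.+1 = i + (1 + (j + (n - i - j))) by clear -lei lej; lia.
    by apply: onto_cat ow (onto_cat (onto1 i) _); rewrite addn1; apply: onto_cat oy oz.
  apply/andP; split; last by case: (x.2.1.2).
  apply: (@avoid_max_cat _ _ _ _ _ _ (i.+1 + j)) => //; last by rewrite addSn ltnS leq_addr.
  + exact: onto_bound ow.
  + by apply: sub_all bLQ => v /andP[].
  + by apply: sub_all bQ => v /andP[].
- case=> L R /mem_objects /= [/andP[aLR nR] oLR].
  have [i [j [L0 [LP [P [LQ [Q [lei lej -> -> [[a0 o0] [a1 o1] [a2 o2]]]]]]]]]] :=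
    avoid_max_split oLR aLR nR.
  exists (i, j), (([::], L0), ((LP, P), (LQ, Q))); split=> //; first exact/memI.
  apply/allpairsP; exists (([::], L0), ((LP, P), (LQ, Q))); split=> //; first exact/mem_objects.
  by apply/allpairsP; exists ((LP, P), (LQ, Q)); split=> //; apply/mem_objects.
- case=> i j [[T L0] [[LP P] [LQ Q]]] [i' j'] [[T' L0'] [[LP' P'] [LQ' Q']]].
  move=> /memI[lei lej] /memX /= [-> [_ o0] [_ o1] [C2 o2]].
  move=> /memI[lei' lej'] /memX /= [-> [_ o0'] [_ o1'] [C2' o2']] [eL eR].
  have le_i k l m A B D E : onto k.+1 l (A ++ B) -> onto (k.+1 + l) m (D ++ E) ->
      all (fun v => k < v) B /\ all (fun v => k < v) E.
    move=> /onto_bound + /onto_bound; rewrite !all_cat => /andP[_ bB] /andP[_ bE].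
    by split; [apply: sub_all bB => v | apply: sub_all bE => v]; clear; lia.
  have [iP iQ] := le_i _ _ _ _ _ _ _ o1 o2; have [iP' iQ'] := le_i _ _ _ _ _ _ _ o1' o2'.
  have min_i k B E : all (fun v => k < v) B -> all (fun v => k < v) E ->
      all (fun v => k <= v) (B ++ k :: E).
    by move=> bB bE; rewrite all_cat /= leqnn; apply/andP; split; [apply: sub_all bB | apply: sub_all bE] => v; apply: ltnW.
  (* [i] is recovered as the minimum of R. *)
  have ei : i = i'.
    apply/eqP; rewrite eqn_leq (allP (min_i _ _ _ iP iQ)) ?eR ?mem_cat ?mem_head ?orbT //.
    by rewrite (allP (min_i _ _ _ iP' iQ')) // -eR mem_cat mem_head orbT.
  rewrite -{}ei in lei' lej' o0' o1' o2' iP' iQ' eR *.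
  have no B : all (fun v => i < v) B -> i \notin B by move=> /allP h; apply/negP => /h; rewrite ltnn.
  have [eP eQ] := cat_cons_inj (no _ iP) (no _ iP') eR.
  rewrite -{}eP -{}eQ {eR iP' iQ'} in o1' o2' C2' *.
  (* [j] is recovered through Q, already known to be common to both decompositions. If [k < l], the
     first upper pair is nonempty and its minimum [i.+1 + k] lies in Q by [low_R], but in the second
     one all values of Q are at least [i.+1 + l]. *)
  have le_j k l A B D : low_incr_class false A D -> l <= n - i ->
      onto (i.+1 + k) (n - i - k) (A ++ D) -> onto (i.+1 + l) (n - i - l) (B ++ D) -> l <= k.
    move=> low lel oA oB; rewrite leqNgt; apply/negP => kl.
    have e : n - i - k = (n - i - k).-1.+1 by clear -kl lel; lia.
    rewrite e in oA; have kD := mem_low_R oA low.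
    have := onto_bound oB; rewrite all_cat => /andP[_ /allP/(_ _ kD)].
    by clear -kl; lia.
  have ej : j = j'.
    by apply/eqP; rewrite eqn_leq (le_j _ _ _ _ _ C2' lej o2' o2) (le_j _ _ _ _ _ C2 lej' o2 o2').
  rewrite -{}ej in lej' o1' o2' *.
  have := onto_bound o1; have := onto_bound o1'; have := onto_bound o2; have := onto_bound o2'.
  rewrite !all_cat => /andP[bLQ' _] /andP[bLQ _] /andP[bLP' _] /andP[bLP _].
  have [-> e1] : L0 = L0' /\ LP ++ LQ = LP' ++ LQ'.
    apply: (cat_threshold_inj (k := i)) eL; rewrite ?(onto_bound o0) ?(onto_bound o0') // all_cat;
      apply/andP; split; ((apply: sub_all bLP || apply: sub_all bLQ) ||
        (apply: sub_all bLP' || apply: sub_all bLQ')) => v; clear; lia.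
  have [-> ->] // : LP = LP' /\ LQ = LQ'.
  by apply: (cat_threshold_inj (k := i.+1 + j)) e1;
    [apply: sub_all bLP | apply: sub_all bLQ | apply: sub_all bLP' | apply: sub_all bLQ']
    => v; clear; lia.
Qed.

(** * Permutations as words *)

Section OneLine.
Variables (n : nat) (p : 'S_n).

Definition one_line : seq nat := [seq val (p i) | i <- enum 'I_n].

(** Replaces increasing maps of positions by subsequences of the one-line word. *)
Lemma contains_patternP (s : seq nat) :
  reflect (exists t, [/\ subseq t one_line, size t = size s &
             forall i j, i < size s -> j < size s ->
               (nth 0 t i < nth 0 t j) = (nth 0 s i < nth 0 s j)])
          (contains_pattern p s).
Proof.
have ltT : transitive (relpre (@nat_of_ord n) ltn) by move=> i j k; apply: ltn_trans.
have enum_lt m : sorted (relpre (@nat_of_ord m) ltn) (enum 'I_m).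
  by rewrite -sorted_map val_enum_ord iota_ltn_sorted.
apply: (iffP existsP) => [[f /forallP fP] | [t [sub_t sz_t tP]]].
  have fE i j := andP (forallP (fP i) j).
  exists [seq val (p (f i)) | i <- enum 'I_(size s)]; rewrite size_map size_enum_ord; split=> //.
    rewrite (map_comp (fun i => val (p i)) f); apply: map_subseq.
    set r := map f _; have r_lt : sorted (relpre (@nat_of_ord n) ltn) r.
      rewrite sorted_map; apply: sub_sorted (enum_lt _) => i j /= ij.
      by have [/implyP/(_ ij)] := fE i j.
    (* A strictly increasing list of ordinals is the enumeration filtered by membership, hence a
       subsequence of it. *)
    have -> : r = filter (mem r) (enum 'I_n).
      apply: (irr_sorted_eq ltT) => // [i||i]; first exact: ltnn.
        exact: (sorted_filter ltT).
      by rewrite mem_filter mem_enum andbT.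
    exact: filter_subseq.
  move=> i j lti ltj; rewrite !(nth_map (Ordinal lti)) -?enumT ?size_enum_ord //.
  have [_ /eqP] := fE (nth (Ordinal lti) (enum 'I_(size s)) i) (nth (Ordinal lti) (enum 'I_(size s)) j).
  by rewrite !nth_enum_ord // => <-.
have /subseqP[m sz_m et] := sub_t; rewrite size_map in sz_m.
pose r := mask m (enum 'I_n); have er : t = [seq val (p i) | i <- r] by rewrite et map_mask.
have sz_r : size r = size s by rewrite -sz_t er size_map.
have r_lt : sorted (relpre (@nat_of_ord n) ltn) r.
  exact: (subseq_sorted ltT (mask_subseq _ _) (enum_lt n)).
pose F (i : 'I_(size s)) := tnth (in_tuple r) (cast_ord (esym sz_r) i).
have FE x0 i : F i = nth x0 r i by apply: tnth_nth.
exists (finfun F); apply/forallP => i; apply/forallP => j; rewrite !ffunE.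
(* Having a position at hand shows that ['I_n] is inhabited, which provides the default value for
   [nth]. *)
have [x0 _] : exists x0 : 'I_n, true by exists (F i).
rewrite !(FE x0); apply/andP; split.
  apply/implyP => ij; apply: (sorted_ltn_nth ltT) ij => //; by rewrite inE sz_r.
by rewrite -tP // er !(nth_map x0) ?sz_r.
Qed.

Lemma avoids_one_line : avoids p [:: 4; 3; 1; 2] && avoids p [:: 3; 1; 4; 2] =
  avoid2 bad_word [::] one_line.
Proof.
rewrite /avoids -negb_or; apply/idP/avoid2P => [noC t u | h].
  rewrite subseq0 => /eqP->; case: u => [|a [|b [|c [|d [|? ?]]]]] // sub_u /=.
  apply: contra noC => /orP[] bad; apply/orP; [left | right];
    apply/contains_patternP; exists [:: a; b; c; d]; split=> // -[|[|[|[|i]]]] -[|[|[|[|j]]]] //= _ _;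
    clear -bad; lia.
apply/negP => /orP[] /contains_patternP[[|a [|b [|c [|d [|? ?]]]]] [sub_t //= _ tP]];
  have := h [::] _ isT sub_t; rewrite /= /bad_quad;
  (* Listed by increasing value, the positions are 2, 3, 1, 0 in 4312 and 1, 3, 0, 2 in 3142;
     consecutive comparisons suffice. *)
  have := tP 2 3 isT isT; have := tP 3 1 isT isT; have := tP 1 0 isT isT;
  have := tP 3 0 isT isT; have := tP 1 3 isT isT; have := tP 0 2 isT isT; rewrite /=; clear; lia.
Qed.
End OneLine.

Lemma a_4312_3142E n : a_4312_3142 n = count_objects (avoid2 bad_word) n.
Proof.
rewrite /a_4312_3142 cardE; symmetry.
pose f (p : 'S_n) : seq nat * seq nat := ([::], one_line p).
apply: (@size_bijection _ _ f); rewrite ?objects_uniq ?enum_uniq //.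
- move=> p; rewrite mem_enum inE avoids_one_line => ap; apply/mem_objects; split=> //=.
  split=> [|v]; first by rewrite map_inj_uniq ?enum_uniq // => i j /val_inj/perm_inj.
  rewrite add0n; apply/mapP/idP => [[i _ ->]|ltvn]; first by rewrite leq0n ltn_ord.
  by exists (p^-1%g (Ordinal ltvn)); rewrite ?mem_enum ?permKV.
- case=> T w /mem_objects /= [aw ow]; have eT := nil_of_bad_word aw; rewrite eT /= in aw ow *.
  have lt_w (i : 'I_n) : nth 0 w i < n.
    by case: ow (onto_size ow) => _ ms sz_w; have := mem_nth 0 (s := w) (n := i);
    rewrite sz_w ms => /(_ (ltn_ord i)).
  pose g (i : 'I_n) := Ordinal (lt_w i).
  have g_inj : injective g.
    move=> i j [] /eqP; rewrite nth_uniq ?(onto_size ow) //; last by case: ow.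
    by move=> /eqP/val_inj.
  have ew : one_line (perm g_inj) = w.
    rewrite /one_line; apply: (@eq_from_nth _ 0); rewrite size_map size_enum_ord ?(onto_size ow) // => i lti.
    by rewrite (nth_map (Ordinal lti)) ?size_enum_ord // permE /= nth_enum_ord.
  exists (perm g_inj); last by rewrite /f ew.
  by rewrite mem_enum inE avoids_one_line ew.
- move=> p q _ _ [/eq_in_map e]; apply/permP => i; apply: val_inj; apply: e; exact: mem_enum.
Qed.

Import GRing.Theory.
Local Open Scope ring_scope.

(** * Power series modulo a power of X *)

Definition trunc (N : nat) (u : nat -> nat) : {poly int} :=
  \poly_(i < N.+1) ((u i)%:R).

Lemma coef_trunc N u k : (k <= N)%N -> (trunc N u)`_k = (u k)%:R.
Proof. by move=> le_kN; rewrite coef_poly ltnS le_kN. Qed.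

Lemma coef_truncM N u v k : (k <= N)%N ->
  (trunc N u * trunc N v)`_k = (\sum_(i < k.+1) u i * v (k - i))%N%:R.
Proof.
move=> le_kN; rewrite coefM natr_sum; apply: eq_bigr => i _.
by rewrite !coef_trunc ?natrM //; have := ltn_ord i; lia.
Qed.

(** Congruence modulo a power of X is kept as an explicit multiple, so that later identities are
    checked by [ring]. *)
Lemma eq_modXn N (p q : {poly int}) : (forall k, (k < N)%N -> p`_k = q`_k) ->
  exists r : {poly int}, p = q + r * 'X^N.
Proof.
move=> eq_pq; exists (drop_poly N (p - q)).
suff e0 : take_poly N (p - q) = 0.
  by apply: (addIr (- q)); rewrite -[LHS](poly_take_drop N) e0; ring.
apply/polyP=> k; rewrite coef_take_poly coef0 coefB; case: ifP => // lt_kN.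
by rewrite eq_pq ?subrr.
Qed.

Lemma trunc_affine N (u w : nat -> nat) c0 : w 0%N = c0 -> (forall n, w n.+1 = u n) ->
  exists r : {poly int}, trunc N w = c0%:R + 'X * trunc N u + r * 'X^(N.+1).
Proof.
move=> w0 wS; apply: eq_modXn => -[|k] lt_kN; rewrite coef_trunc //.
  by rewrite coefD coefXM -polyC_natr coefC addr0 w0.
rewrite coefD coefXM -polyC_natr coefC.
by rewrite add0r /= coef_trunc ?wS //; lia.
Qed.

Lemma trunc_conv N (u v w : nat -> nat) : (forall n, w n = \sum_(i < n.+1) u i * v (n - i))%N ->
  exists r : {poly int}, trunc N w = trunc N u * trunc N v + r * 'X^(N.+1).
Proof.
by move=> wE; apply: eq_modXn => k lt_kN; rewrite coef_truncM // coef_trunc // wE.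
Qed.

Lemma trunc_add N (u v w : nat -> nat) : (forall n, w n = u n + v n)%N ->
  trunc N w = trunc N u + trunc N v.
Proof.
by move=> wE; apply/polyP=> k; rewrite coefD !coef_poly; case: ifP; rewrite ?addr0 // wE natrD.
Qed.

(** * Elimination down to the quartic *)

Definition quartic (f : {poly int}) : {poly int} :=
   ('X^3 - 2%:P * 'X^2 + 'X) * f ^+ 4
   + (4%:P * 'X^3 - 9%:P * 'X^2 + 6%:P * 'X - 1) * f ^+ 3
   + (6%:P * 'X^3 - 12%:P * 'X^2 + 7%:P * 'X - 1) * f ^+ 2
   + (4%:P * 'X^3 - 5%:P * 'X^2 + 'X) * f
   + 'X^3.

Lemma quartic_cong M (f g r : {poly int}) : f = g + r * 'X^M ->
  exists s, quartic f = quartic g + s * 'X^M.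
Proof.
move=> ->; rewrite /quartic; move: ('X^M) => Z.
(* By the binomial theorem the factors in g, r and Z are the quotients of (g + rZ)^k - g^k by rZ. *)
exists (r * (('X^3 - 2%:P * 'X^2 + 'X) * (4%:R * g ^+ 3 + 6%:R * g ^+ 2 * r * Z + 4%:R * g * r ^+ 2 * Z ^+ 2 + r ^+ 3 * Z ^+ 3)
   + (4%:P * 'X^3 - 9%:P * 'X^2 + 6%:P * 'X - 1) * (3%:R * g ^+ 2 + 3%:R * g * r * Z + r ^+ 2 * Z ^+ 2)
   + (6%:P * 'X^3 - 12%:P * 'X^2 + 7%:P * 'X - 1) * (2%:R * g + r * Z)
   + (4%:P * 'X^3 - 5%:P * 'X^2 + 'X))).
ring.
Qed.

Section Elim.
Variables (R : comPzRingType) (x f c K C G Z : R).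

Lemma quartic_elimination rA rG rC rK rc :
  1 + f = 1 + x * G + rA * Z ->
  G = (1 + f) + x * ((1 + f) * (G * C)) + rG * Z ->
  C = 1 + x * (c * K) + rC * Z ->
  K = C + x * K + rK * Z ->
  c = 1 + x * (c * c) + rc * Z ->
  exists s, x * ((x ^+ 3 - 2%:R * x ^+ 2 + x) * f ^+ 4
   + (4%:R * x ^+ 3 - 9%:R * x ^+ 2 + 6%:R * x - 1) * f ^+ 3
   + (6%:R * x ^+ 3 - 12%:R * x ^+ 2 + 7%:R * x - 1) * f ^+ 2
   + (4%:R * x ^+ 3 - 5%:R * x ^+ 2 + x) * f
   + x ^+ 3) = s * Z.
Proof.
move=> eA eG eC eK ec.
(* Modulo Z, (1 - x - xc) K = 1 and (1 - x - xc) C = 1 - x, so the equation for f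
   becomes linear in xc, namely D (xc) = N, and (xc)^2 - xc + x = 0 gives
   N^2 - N D + x D^2 = 0. *)
have [s1 e1] : exists s, K * (1 - x - x * c) = 1 + s * Z.
  exists (rC + rK).
  have -> : K * (1 - x - x * c) = K - x * K - x * (c * K) by ring.
  by rewrite {1}eK {1}eC; ring.
have [s2 e2] : exists s, C * (1 - x - x * c) = 1 - x + s * Z.
  exists ((1 - x) * s1 - rK * (1 - x - x * c)).
  have -> : C = K - x * K - rK * Z by rewrite {1}eK; ring.
  transitivity ((1 - x) * (K * (1 - x - x * c)) - rK * Z * (1 - x - x * c)); first by ring.
  by rewrite e1; ring.
have [s3 e3] : exists s, f * (1 - x * (1 + f) * C) = x * (1 + f) + s * Z.
  have ef : f = x * G + rA * Z by apply: (addrI 1); rewrite eA; ring.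
  exists (rA * (1 - x * (1 + f) * C) + x * rG).
  have eG' : G * (1 - x * (1 + f) * C) = 1 + f + rG * Z.
    have -> : G * (1 - x * (1 + f) * C) = G - x * ((1 + f) * (G * C)) by ring.
    by rewrite {1}eG; ring.
  transitivity (x * (G * (1 - x * (1 + f) * C)) + rA * Z * (1 - x * (1 + f) * C)).
    by rewrite {1}ef; ring.
  by rewrite eG'; ring.
pose D := x * (1 + f) - f; pose N := (1 - x) * (x * (1 + f) ^+ 2 - f).
have [s4 e4] : exists s, D * (x * c) = N + s * Z.
  exists (s3 * (1 - x - x * c) + x * (1 + f) * f * s2).
  have h : f * (1 - x - x * c) - x * (1 + f) * f * (C * (1 - x - x * c)) =
           (x * (1 + f) + s3 * Z) * (1 - x - x * c) by rewrite -e3; ring.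
  rewrite e2 in h.
  (* An equation is turned into a zero added to the goal, so that [ring] can prove the goal modulo
     [h]. *)
  have h' : forall u v : R, u = v -> 0 = v - u by move=> u v ->; ring.
  rewrite -[LHS]addr0 (h' _ _ h) /D /N; ring.
have -> : x * ((x ^+ 3 - 2%:R * x ^+ 2 + x) * f ^+ 4
   + (4%:R * x ^+ 3 - 9%:R * x ^+ 2 + 6%:R * x - 1) * f ^+ 3
   + (6%:R * x ^+ 3 - 12%:R * x ^+ 2 + 7%:R * x - 1) * f ^+ 2
   + (4%:R * x ^+ 3 - 5%:R * x ^+ 2 + x) * f
   + x ^+ 3) = N ^+ 2 - N * D + x * D ^+ 2 by rewrite /N /D; ring.
have -> : N = D * (x * c) - s4 * Z by rewrite e4; ring.
(* The first term collects what [s4] contributes to N^2 - ND; the second comes from (xc)^2 - xc + x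
   = -x rc Z. *)
exists (s4 * (s4 * Z - 2%:R * (D * (x * c)) + D) - D ^+ 2 * x * rc).
have h : x * D ^+ 2 * (c - (1 + x * (c * c) + rc * Z)) = 0 by rewrite -ec subrr mulr0.
rewrite -[LHS]addr0 -h; ring.
Qed.
End Elim.

Lemma quartic_of_system (a g c K C : nat -> nat) (N : nat) :
  a 0%N = 1%N -> (forall n, a n.+1 = g n) ->
  g 0%N = 1%N ->
  (forall n, g n.+1 = a n.+1 + \sum_(i < n.+1) a i * \sum_(j < (n - i).+1) g j * C (n - i - j))%N ->
  C 0%N = 1%N -> (forall n, C n.+1 = \sum_(i < n.+1) c i * K (n - i))%N ->
  K 0%N = 1%N -> (forall n, K n.+1 = C n.+1 + K n)%N ->
  c 0%N = 1%N -> (forall n, c n.+1 = \sum_(i < n.+1) c i * c (n - i))%N ->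
  forall k, (k <= N)%N -> (quartic (trunc N a - 1))`_k = 0.
Proof.
move=> a0 aS g0 gS C0 CS K0 KS c0 cS k le_kN.
(* One degree more than [N]: the elimination only yields X times the quartic, and cancelling X costs
   a degree. *)
pose M := N.+1.
pose gC n := (\sum_(j < n.+1) g j * C (n - j))%N.
pose agC n := (\sum_(j < n.+1) a j * gC (n - j))%N.
pose cK n := (\sum_(j < n.+1) c j * K (n - j))%N.
pose cc n := (\sum_(j < n.+1) c j * c (n - j))%N.
(* The shift is multiplication by X; with it g = a + [sh agC] and K = C + [sh K] hold at index 0 as
   well. *)
pose sh (u : nat -> nat) n := if n is n'.+1 then u n' else 0%N.
have tsh u : exists r : {poly int}, 
    trunc M (sh u) = 0%:R + 'X * trunc M u + r * 'X^(M.+1) by exact: trunc_affine.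
have [r1 e1] := trunc_affine M a0 aS.
have [r2 e2] := trunc_conv M (fun n => erefl (gC n)).
have [r3 e3] := trunc_conv M (fun n => erefl (agC n)).
have [r4 e4] := trunc_conv M (fun n => erefl (cK n)).
have [r5 e5] := trunc_conv M (fun n => erefl (cc n)).
have [r6 e6] := trunc_affine M c0 cS.
have [r7 e7] := trunc_affine M C0 CS.
have eK : trunc M K = trunc M C + trunc M (sh K).
  by apply: trunc_add => -[|n] /=; rewrite ?K0 ?C0.
have [r8 e8] := tsh K.
have eg : trunc M g = trunc M a + trunc M (sh agC).
  by apply: trunc_add => -[|n] /=; rewrite ?g0 ?a0.
have [r9 e9] := tsh agC.
(* Passing from degree [N] to [M] changes the quartic only by a multiple of X^M, which does not
   affect the coefficient of index k <= N. *)
have [r hr] : exists r : {poly int}, trunc N a - 1 = (trunc M a - 1) + r * 'X^M.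
  apply: eq_modXn => j lt_jM; rewrite !coefB !coef_trunc //; lia.
have [s ->] := quartic_cong hr.
rewrite coefD coefMXn ltnS le_kN addr0.
have e3' : trunc M agC = trunc M a * (trunc M g * trunc M C) + (trunc M a * r2 + r3) * 'X^(M.+1).
  by rewrite e3 e2; ring.
set f := trunc M a - 1.
have aE : trunc M a = 1 + f by rewrite /f; ring.
have [t et] := @quartic_elimination {poly int} 'X f (trunc M c) (trunc M K) (trunc M C) (trunc M g) 'X^(M.+1)
   r1 ('X * (trunc M a * r2 + r3) + r9) ('X * r4 + r7) r8 ('X * r5 + r6)
   ltac:(rewrite -aE; exact e1)
   ltac:(rewrite -aE {1}eg e9 e3'; ring) ltac:(rewrite {1}e7 e4; ring)
   ltac:(rewrite {1}eK e8; ring) ltac:(rewrite {1}e6 e5; ring).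
have : ('X * quartic f)`_k.+1 = 0.
  have -> : 'X * quartic f = t * 'X^(M.+1) by rewrite -et /quartic; ring.
  by rewrite coefMXn /M; case: ltnP => //; lia.
by rewrite coefXM.
Qed.

Lemma count_objects0 (P : rel (seq nat)) : P [::] [::] -> count_objects P 0 = 1%N.
Proof. by move=> P0; rewrite /count_objects /objects /= P0. Qed.

(** The series of the counts includes the empty permutation; subtracting 1 removes it. *)
Lemma f_truncE N : f_trunc N = trunc N a_4312_3142 - 1.
Proof.
apply/polyP=> -[|k]; rewrite coefB coef1 !coef_poly /=.
  by rewrite a_4312_3142E count_objects0 ?subrr.
by case: ifP; rewrite subr0.
Qed.

(* The formal power series identity P(x, f) = 0 holds iff, for every N, the
   coefficients of degree <= N of P(x, f_N) vanish, where f_N is the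
   truncation of f to degree N (coefficient k of P(x,f) only depends on
   a_0..a_k). *)
Theorem theorem4p2 (N k : nat) : (k <= N)%N ->
  (let f := f_trunc N in
   ('X^3 - 2%:P * 'X^2 + 'X) * f ^+ 4
   + (4%:P * 'X^3 - 9%:P * 'X^2 + 6%:P * 'X - 1) * f ^+ 3
   + (6%:P * 'X^3 - 12%:P * 'X^2 + 7%:P * 'X - 1) * f ^+ 2
   + (4%:P * 'X^3 - 5%:P * 'X^2 + 'X) * f
   + 'X^3 : {poly int})`_k = 0.
Proof.
move=> le_kN; suff: (quartic (f_trunc N))`_k = 0 by []; rewrite f_truncE.
(* The four sequences given are the coefficients of G, c, K and C. *)
apply: (@quartic_of_system _ (count_objects (avoid2 bad_max)) (count_objects (incr_class true))
  (count_objects (incr_class false)) (count_objects (low_incr_class false))) le_kN.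
- by rewrite a_4312_3142E count_objects0.
- by move=> n; rewrite a_4312_3142E count_word_max.
- by rewrite count_objects0.
- move=> n; rewrite a_4312_3142E count_max; congr addn.
  by apply: eq_bigr => i _; rewrite a_4312_3142E.
- by rewrite count_objects0.
- exact: count_low_incr.
- by rewrite count_objects0.
- exact: count_incr.
- by rewrite count_objects0.
- by move=> n; rewrite -count_incr_true count_low_incr.
Qed.
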